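(* Let $\boldsymbol{\mu}=(\mu_1,\ldots,\mu_n)$ be an $n$-tuple of umbral monomials with generating function $f(\boldsymbol{\mu},\boldsymbol{t})$, and let $\gamma$ be an umbra with generating function $f(\gamma,t)$. Then the auxiliary umbra $(\mu_1+\cdots+\mu_n)\boldsymbol{.}\beta\boldsymbol{.}\gamma$ has generating function $$f[(\mu_1+\cdots+\mu_n)\boldsymbol{.}\beta\boldsymbol{.}\gamma,\,t]=f[\boldsymbol{\mu},(f(\gamma,t)-1,\ldots,f(\gamma,t)-1)],$$ an identity of formal power series in the single variable $t$ (with $n$ equal arguments $f(\gamma,t)-1$ on the right).
   Context: $R$ is the real or complex field, $A$ is a set (the alphabet) whose elements are called umbrae, and $E:R[A]\to R$ is a linear functional (evaluation) with $E[1]=1$ and $E[\alpha^i\gamma^j\cdots]=E[\alpha^i]E[\gamma^j]\cdots$ for distinct umbrae and nonnegative integers $i,j,\dots$. The moments of $\gamma\in A$ are $g_k=E[\gamma^k]$, and its generating function is $f(\gamma,t)=1+\sum_{k\ge1}g_k t^k/k!$. An $n$-tuple $\boldsymbol{\mu}=(\mu_1,\dots,\mu_n)$ of umbral monomials (monomials in $R[A]$, supports not necessarily disjoint) has multivariate moments $E[\boldsymbol{\mu}^{\boldsymbol{i}}]$, $\boldsymbol{\mu}^{\boldsymbol{i}}=\mu_1^{i_1}\cdots\mu_n^{i_n}$, $\boldsymbol{i}\in\mathbb{N}_0^n$, and generating function $f(\boldsymbol{\mu},\boldsymbol{t})=1+\sum_{\boldsymbol{i}\neq\boldsymbol{0}}E[\boldsymbol{\mu}^{\boldsymbol{i}}]\,\boldsymbol{t}^{\boldsymbol{i}}/\boldsymbol{i}!$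 with $\boldsymbol{i}!=i_1!\cdots i_n!$, $\boldsymbol{t}=(t_1,\dots,t_n)$, $\boldsymbol{t}^{\boldsymbol{i}}=t_1^{i_1}\cdots t_n^{i_n}$. For formal power series $s_1,\dots,s_n$ without constant term, $f[\boldsymbol{\mu},(s_1,\dots,s_n)]$ denotes the substitution $t_j\mapsto s_j$ in $f(\boldsymbol{\mu},\boldsymbol{t})$. For an integer partition $\lambda=(1^{r_1},2^{r_2},\dots)\vdash i$ let $\nu_\lambda=r_1+r_2+\cdots$ be its length, $\mathfrak{m}(\lambda)!=r_1!r_2!\cdots$, $\lambda!=(1!)^{r_1}(2!)^{r_2}\cdots$. The auxiliary umbra $p\boldsymbol{.}\beta\boldsymbol{.}\gamma$ ($\beta$ denotes the Bell umbra), for an umbral polynomial $p\in R[A]$ (here $p=\mu_1+\cdots+\mu_n$), is defined by its moments $$E[(p\boldsymbol{.}\beta\boldsymbol{.}\gamma)^i]=\sum_{\lambda\vdash i}\frac{i!}{\mathfrak{m}(\lambda)!\,\lambda!}\,E[p^{\nu_\lambda}]\,g_1^{r_1}g_2^{r_2}\cdots,\qquad i\ge0,$$ and its generating function is $f[p\boldsymbol{.}\beta\boldsymbol{.}\gamma,t]=1+\sum_{i\ge1}E[(p\boldsymbol{.}\beta\boldsymbol{.}\gamma)^i]\,t^i/i!$. *)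

(* Defs.v *)
From HB Require Import structures.
From mathcomp Require Import all_boot all_order all_algebra.
From mathcomp Require Import reals complex.
From mathcomp Require Import monalg.
(* [mpoly] comes after [monalg], so ['X_{1..n}], [mdeg] and [mnmwgt] are those
   of [mpoly]; [monalg] supplies the polynomial algebra over the alphabet. *)
From mathcomp Require Import mpoly.

Set Implicit Arguments.
Unset Strict Implicit.
Unset Printing Implicit Defensive.

Import Order.TTheory GRing.Theory Num.Theory.

Local Open Scope ring_scope.

Variant real_or_complex (F : realType) : numFieldType -> Prop :=
  | RealScalars : real_or_complex F F
  | ComplexScalars : real_or_complex F F[i].

Section PowerSeries.
Context {R : fieldType}.

(* [s k] is the plain coefficient of [t^k]: the factorials of an exponential
   generating function are part of the coefficients.  Equality of power series
   is [=1]. *)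
Definition fps : Type := nat -> R.
Definition mfps (n : nat) : Type := 'X_{1..n} -> R.

Definition fps_one : fps := fun k => (k == 0)%:R.
Definition fps_mul (s u : fps) : fps :=
  fun k => \sum_(l < k.+1) s l * u (k - l)%N.
Definition fps_exp (s : fps) (m : nat) : fps := iter m (fps_mul s) fps_one.
Definition fps_mexp n (s : 'I_n -> fps) (i : 'X_{1..n}) : fps :=
  \big[fps_mul/fps_one]_(j < n) fps_exp (s j) (i j).

(* Substitution of series without constant term: [s^i] then has order at least
   [mdeg i], so only the multi-indices of degree at most [k] contribute to the
   coefficient of [t^k]; see [fps_subst_widen].  The value is meaningless if
   some [s j] has a constant term. *)
Definition fps_subst n (c : mfps n) (s : 'I_n -> fps) : fps :=
  fun k => \sum_(i : 'X_{1..n < k.+1}) c i * fps_mexp s i k.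

Definition egf (g : nat -> R) : fps :=
  fun k => if k == 0 then 1 else g k / k`!%:R.
Definition megf n (g : 'X_{1..n} -> R) : mfps n :=
  fun i => if i == 0%MM then 1 else g i / (\prod_(j < n) (i j)`!)%:R.

Lemma egf_sub1_0 (g : nat -> R) : (egf g \- fps_one) 0 = 0.
Proof. by rewrite /= /egf /fps_one eqxx subrr. Qed.

Lemma fps_mul_order a b (s u : fps) :
  (forall k, (k < a)%N -> s k = 0) -> (forall k, (k < b)%N -> u k = 0) ->
  forall k, (k < a + b)%N -> fps_mul s u k = 0.
Proof.
move=> Hs Hu k Hk; rewrite /fps_mul big1 // => l _.
have [la|al] := ltnP l a; first by rewrite Hs // mul0r.
rewrite Hu ?mulr0 // ltn_subLR; last by rewrite -ltnS.
by apply: leq_trans Hk _; rewrite leq_add2r.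
Qed.

Lemma fps_mexp_order n (s : 'I_n -> fps) (i : 'X_{1..n}) k :
  (forall j, s j 0 = 0) -> (k < mdeg i)%N -> fps_mexp s i k = 0.
Proof.
move=> s0; rewrite mdegE /fps_mexp; move: k.
pose K (u : fps) d := forall k, (k < d)%N -> u k = 0.
change (K (\big[fps_mul/fps_one]_(j < n) fps_exp (s j) (i j))
          (\sum_(j < n) i j)%N).
elim/big_ind2: _ => [//|u a v b Hu Hv|j _]; first exact: fps_mul_order.
elim: (i j) => [//|m IHm]; rewrite -[m.+1]add1n.
by apply: fps_mul_order IHm => -[].
Qed.

Lemma fps_subst_widen n (c : mfps n) (s : 'I_n -> fps) k N :
  (forall j, s j 0 = 0) -> (k < N)%N ->
  fps_subst c s k = \sum_(i : 'X_{1..n < N}) c i * fps_mexp s i k.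
Proof.
move=> s0 kN; rewrite /fps_subst.
rewrite [RHS](bigID (fun i : 'X_{1..n < N} => (mdeg i < k.+1)%N)) /=.
rewrite [X in _ = _ + X]big1 ?addr0; last first.
  by move=> i; rewrite -leqNgt => ki; rewrite fps_mexp_order ?mulr0.
pose F (i : 'X_{1..n}) := c i * fps_mexp s i k.
rewrite (reindex_onto (fun i : 'X_{1..n < k.+1} =>
    BMultinom (leq_trans (bmdeg i) kN))
  (fun i : 'X_{1..n < N} => insubd bm0 (bmnm i))) /=.
  apply: eq_big => [i|//]; rewrite bmdeg /=.
  by apply/esym/eqP/val_inj; rewrite val_insubd bmdeg.
by move=> i Hi; apply/val_inj; rewrite /= val_insubd Hi.
Qed.

End PowerSeries.

Arguments fps : clear implicits.
Arguments mfps : clear implicits.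

Notation umbral_poly R A := {malg R[{cmonom A}]}.

Section Umbrae.
Context {R : numFieldType} {A : choiceType}.
Implicit Types (E : {scalar umbral_poly R A}) (p : umbral_poly R A).

(* Umbral monomials are power products of umbrae, with coefficient 1. *)
Definition umonom (m : {cmonom A}) : umbral_poly R A := << m >>.
Definition umbra (a : A) : umbral_poly R A := umonom (ucm a).

Definition evaluation E : Prop :=
  E 1 = 1 /\
  forall (s : seq A) (k : A -> nat), uniq s ->
    E (\prod_(a <- s) umbra a ^+ k a) = \prod_(a <- s) E (umbra a ^+ k a).

Definition moment E (a : A) (k : nat) : R := E (umbra a ^+ k).
Definition umbra_gf E (a : A) : fps R := egf (moment E a).

Definition mmoment E n (mu : 'I_n -> {cmonom A}) (i : 'X_{1..n}) : R :=
  E (\prod_(j < n) umonom (mu j) ^+ i j).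
Definition mumbra_gf E n (mu : 'I_n -> {cmonom A}) : mfps R n :=
  megf (mmoment E mu).

(* A partition [(1^{r_1}, 2^{r_2}, ...)] of [i] is encoded by its
   multiplicities, [l j = r_(j+1)] for [j < i]; then [mnmwgt l] is the sum of
   the parts and [mdeg l] the length.  The bound on [mdeg l] only makes the
   index type finite, see [mdeg_le_mnmwgt]. *)
Definition dot_bell_moment E p (a : A) (i : nat) : R :=
  \sum_(l : 'X_{1..i < i.+1} | mnmwgt l == i)
    i`!%:R / ((\prod_(j < i) (l j)`!) * (\prod_(j < i) j.+1`! ^ l j))%:R
    * E (p ^+ mdeg l) * \prod_(j < i) moment E a j.+1 ^+ l j.
Definition dot_bell_gf E p (a : A) : fps R := egf (dot_bell_moment E p a).

End Umbrae.

Lemma mdeg_le_mnmwgt n (l : 'X_{1..n}) : (mdeg l <= mnmwgt l)%N.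
Proof. by rewrite mdegE /mnmwgt leq_sum // => j _; rewrite leq_pmulr. Qed.

(* Main.v *)
(** By the multinomial theorem [E (p ^ m) / m! = \sum_(|i| = m) E (mu ^ i) / i!]
    for [p = mu_1 + ... + mu_n], and the coefficient of [t ^ k] in
    [(f(gamma, t) - 1) ^ m] is the sum of [m! / m(l)! * \prod_j (g_j / j!) ^ l_j]
    over the partitions [l] of [k] of length [m].  Both sides of the theorem are
    therefore the same double sum over pairs [(i, l)] with [|i| = |l|]. *)
Require Import Defs.
From mathcomp Require Import all_boot all_order all_algebra.
From mathcomp Require Import reals complex monalg mpoly.

Import Order.TTheory GRing.Theory Num.Theory.
Local Open Scope ring_scope.

Lemma expr_sumX_homog (R : comNzRingType) n m :
  (\sum_(i < n) 'X_i : mpoly n R) ^+ m \is m.-homog.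
Proof.
rewrite -[m in X in _ \is X]mul1n; apply/dhomogMn/rpred_sum => i _.
by rewrite dhomogX; apply/eqP/mdeg1.
Qed.

(** With the factorials kept on the left, no division occurs and any commutative ring is allowed.
    The induction on [m] lowers [k] by a partial derivative. *)
Lemma mcoeff_expr_sumX (R : comNzRingType) n m (k : 'X_{1..n}) :
  mcoeff k ((\sum_(i < n) 'X_i) ^+ m : mpoly n R) * (\prod_(i < n) (k i)`!)%:R
  = (m`! * (mdeg k == m))%:R.
Proof.
have [kd|kd] := eqVneq (mdeg k) m; last first.
  by rewrite (dhomog_nemf_coeff (expr_sumX_homog _ _ m)) // mul0r muln0.
rewrite muln1; elim: m k kd => [|m IHm] k kd.
  move/eqP: kd; rewrite mdeg_eq0 => /eqP ->.
  by rewrite expr0 mcoeff1 eqxx mul1r big1 // => i _; rewrite mnm0E.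
have [i ki] : exists i, k i != 0%N.
  apply/existsP; rewrite -negb_forall; apply/negP => /forallP k0.
  by move: kd; rewrite mdegE big1 // => i _; apply/eqP/k0.
have kE : k = (k - U_(i) + U_(i))%MM by rewrite submK // lep1mP.
set k' := (k - U_(i))%MM in kE.
have k'd : mdeg k' = m by move: kd; rewrite kE mdegD mdeg1 addn1 => -[].
(* Differentiating in a variable occurring in [k] lowers the degree by one. *)
have derS (d : nat) : mderiv i ((\sum_(j < n) 'X_j : mpoly n R) ^+ d.+1)
    = (\sum_(j < n) 'X_j) ^+ d *+ d.+1.
  have der1 : mderiv i (\sum_(j < n) 'X_j : mpoly n R) = 1.
    rewrite raddf_sum (bigD1 i) //= big1 ?addr0.
      by rewrite mderivX mnm1E eqxx scale1r -[X in (X - _)%MM]add0m addmK mpolyX0.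
    by move=> j ji; rewrite mderivX mnm1E (negbTE ji) scale0r.
  elim: d => [|d IHd]; first by rewrite expr1 der1 expr0.
  by rewrite exprS mderivM der1 mul1r IHd mulrnAr -exprS [in RHS]mulrS.
have -> : (\prod_(j < n) (k j)`! = (k' i).+1 * \prod_(j < n) (k' j)`!)%N.
  rewrite (bigD1 i) // [in RHS](bigD1 i) //= mulnA; congr (_ * _)%N.
    by rewrite kE mnmDE mnm1E eqxx addn1 factS.
  by apply: eq_bigr => j ji; rewrite kE mnmDE mnm1E eq_sym (negbTE ji) addn0.
(* The factor [(k' i).+1] is the one that differentiation produces at [k']. *)
rewrite natrM mulrA [X in X * _]mulr_natr [X in mcoeff X]kE -mcoeff_deriv derS mcoeffMn.
by rewrite mulrnAl IHm // factS -mulr_natl -natrM.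
Qed.

(** Evaluating ['X_i] at [x i] carries the identity to any commutative algebra: umbral polynomials
    for [E (p ^+ m)], and [{poly R}] for truncated series. [N] only bounds the index type. *)
Lemma multinomial_expansion (R : numFieldType) (V : comAlgType R) n
    (x : 'I_n -> V) m N : (m < N)%N ->
  (\sum_(i < n) x i) ^+ m
  = \sum_(k : 'X_{1..n < N} | mdeg k == m)
      (m`!%:R / (\prod_(i < n) (k i)`!)%:R) *: \prod_(i < n) x i ^+ k i.
Proof.
move=> mN.
pose ev : mpoly n R -> V := mmap (in_alg V) x.
have -> : (\sum_(i < n) x i) ^+ m = ev ((\sum_(i < n) 'X_i) ^+ m).
  rewrite /ev rmorphXn rmorph_sum; congr (_ ^+ _); apply: eq_bigr => i _.
  by rewrite /= mmapX mmap1U.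
have coefE (k : 'X_{1..n}) : mcoeff k ((\sum_(i < n) 'X_i) ^+ m : mpoly n R)
    = if mdeg k == m then m`!%:R / (\prod_(i < n) (k i)`!)%:R else 0.
  have fk : (\prod_(i < n) (k i)`!)%:R != 0 :> R.
    by rewrite pnatr_eq0 -lt0n prodn_gt0 // => i; apply: fact_gt0.
  apply: (mulIf fk); rewrite mcoeff_expr_sumX.
  by case: eqP => _; rewrite ?muln1 ?divfK // muln0 mul0r.
rewrite (mpolywE (k := N) (p := _ ^+ m)); last first.
  rewrite msizeE; apply/bigmax_leqP_seq => k.
  move=> /(dhomog_mf (expr_sumX_homog R n m)) + _.
  by move=> /= ->.
rewrite /ev rmorph_sum [RHS]big_mkcond /=; apply: eq_bigr => k _.
rewrite coefE /= mmapZ mmapX; case: eqP => _; last first.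
  by rewrite rmorph0 mul0r.
by rewrite mulr_algl.
Qed.

Arguments multinomial_expansion {R V n} x m N.

Lemma dot_bell_gfE (R : numFieldType) (A : choiceType)
    (E : {scalar umbral_poly R A}) (p : umbral_poly R A) a k : E 1 = 1 ->
  dot_bell_gf E p a k =
  \sum_(l : 'X_{1..k < k.+1} | mnmwgt l == k)
    E (p ^+ mdeg l) *
      (\prod_(j < k) umbra_gf E a j.+1 ^+ l j / (\prod_(j < k) (l j)`!)%:R).
Proof.
move=> E1.
have -> : dot_bell_gf E p a k = dot_bell_moment E p a k / k`!%:R.
  (* Only [k = 0] needs care: there [egf] imposes the value 1, and the empty partition gives
     [E 1]. *)
  case: k => [|//]; rewrite /dot_bell_gf /egf /= /dot_bell_moment.
  rewrite (big_pred1 bm0) => [|l].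
    by rewrite !big_ord0 mdeg0 expr0 E1 muln1 !divr1 !mulr1.
  apply/eqP/eqP => [_|->]; last by rewrite mnmwgt0.
  by apply/val_inj/mnmP => -[].
rewrite mulr_suml; apply: eq_bigr => l _.
have -> : \prod_(j < k) umbra_gf E a j.+1 ^+ l j
   = (\prod_(j < k) moment E a j.+1 ^+ l j) / (\prod_(j < k) j.+1`! ^ l j)%:R.
  rewrite natr_prod -prodf_div; apply: eq_bigr => j _.
  by rewrite expr_div_n natrX.
have fk : k`!%:R != 0 :> R by rewrite pnatr_eq0 -lt0n fact_gt0.
rewrite natrM invfM [LHS]mulrC !mulrA mulVf // mul1r.
by rewrite -[LHS]mulrA [LHS]mulrC [_^-1 * _]mulrC !mulrA.
Qed.

(** Coefficients up to [k] of a product depend only on those up to [k] of its factors, so series may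
    be truncated to polynomials. *)
Lemma fps_mexp_coef (R : fieldType) n (s : 'I_n -> fps R) (P : 'I_n -> {poly R})
    (i : 'X_{1..n}) k :
  (forall j l, (l <= k)%N -> s j l = (P j)`_l) ->
  fps_mexp s i k = (\prod_(j < n) P j ^+ i j)`_k.
Proof.
move=> sP.
pose K (u : fps R) (Q : {poly R}) := forall l, (l <= k)%N -> u l = Q`_l.
have K1 : K (fps_one (R := R)) 1 by move=> l _; rewrite coef1.
have KM u Q v T : K u Q -> K v T -> K (fps_mul u v) (Q * T).
  move=> uQ vT l lk; rewrite coefM; apply: eq_bigr => r _.
  by rewrite uQ ?vT // (leq_trans _ lk) ?leq_subr // -ltnS.
suff: K (fps_mexp s i) (\prod_(j < n) P j ^+ i j) by apply.
rewrite /fps_mexp; apply: (big_ind2 K) => // j _.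
by elim: (i j) => [|m IHm] //; rewrite exprS; apply: KM IHm; apply: sP.
Qed.

(** Equal arguments give the power [mdeg i] of one series. Expanded over the terms of its
    truncation, the monomial [l] carries the exponent [mnmwgt l], so extracting degree [k] selects
    partitions of [k]. *)
Lemma fps_mexp_const_coef (R : numFieldType) n (s : fps R) (i : 'X_{1..n}) k :
  s 0 = 0 -> (mdeg i <= k)%N ->
  fps_mexp (fun=> s) i k
  = \sum_(l : 'X_{1..k < k.+1} | (mdeg l == mdeg i) && (mnmwgt l == k))
      (mdeg i)`!%:R * (\prod_(j < k) s j.+1 ^+ l j / (\prod_(j < k) (l j)`!)%:R).
Proof.
move=> s0 ik; pose P : {poly R} := \sum_(j < k) s j.+1 *: 'X^(j.+1).
have PE l : (l <= k)%N -> s l = P`_l.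
  rewrite coef_sum; case: l => [_|l lk].
    by rewrite s0 big1 // => j _; rewrite coefZ coefXn mulr0.
  rewrite (bigD1 (Ordinal lk)) //= coefZ coefXn eqxx mulr1 big1 ?addr0 // => j jl.
  by rewrite coefZ coefXn eqSS eq_sym (_ : (_ == _) = false) ?mulr0 //; apply: negbTE jl.
rewrite (fps_mexp_coef _ _ _ (fun=> P)); last by move=> _.
rewrite prodrXr -mdegE (multinomial_expansion _ _ k.+1) // coef_sum big_mkcondr /=.
apply: eq_bigr => l _; rewrite coefZ.
have -> : \prod_(j < k) (s j.+1 *: 'X^(j.+1)) ^+ l j
    = (\prod_(j < k) s j.+1 ^+ l j) *: 'X^(mnmwgt l) :> {poly R}.
  under eq_bigr do rewrite exprZn -exprM mulnC.
  by rewrite scaler_prod prodrXr.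
rewrite coefZ coefXn eq_sym; case: eqP => _; last by rewrite !mulr0.
by rewrite mulr1 mulrAC mulrA.
Qed.

Lemma mumbra_gfE (R : numFieldType) (A : choiceType)
    (E : {scalar umbral_poly R A}) n (mu : 'I_n -> {cmonom A}) i : E 1 = 1 ->
  mumbra_gf E mu i = mmoment E mu i / (\prod_(j < n) (i j)`!)%:R.
Proof.
move=> E1; rewrite /mumbra_gf /megf; case: eqP => // ->.
rewrite /mmoment !big1 => [|j _|j _]; rewrite ?mnm0E ?expr0 //.
by rewrite E1 divr1.
Qed.

Theorem theorem3p2 (F : realType) (R : numFieldType)
    (hR : real_or_complex F R) (A : choiceType)
    (E : {scalar umbral_poly R A}) (hE : evaluation E)
    (n : nat) (mu : 'I_n -> {cmonom A}) (gamma : A) :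
  dot_bell_gf E (\sum_(j < n) umonom (mu j)) gamma
  =1 fps_subst (mumbra_gf E mu) (fun _ : 'I_n => umbra_gf E gamma \- fps_one).
Proof.
case: hE => E1 _ k; rewrite dot_bell_gfE // /fps_subst.
under [RHS]eq_bigr => i _.
  rewrite fps_mexp_const_coef ?egf_sub1_0 -1?ltnS ?bmdeg //.
  rewrite mulr_sumr; over.
(* The partition [l] becomes the outer index, as on the left-hand side. *)
rewrite /= (exchange_big_dep (fun l : 'X_{1..k < k.+1} => mnmwgt l == k)) /=;
  last by move=> i l _ /andP[].
apply: eq_bigr => l lk.
(* For fixed [l], the multi-indices [i] with [mdeg i = mdeg l] are those in the expansion of the
   power [mdeg l]. *)
rewrite (multinomial_expansion _ _ k.+1) ?bmdeg // linear_sum mulr_suml /=.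
apply: eq_big => [i|i /eqP il]; first by rewrite lk andbT eq_sym.
rewrite linearZ /= mumbra_gfE // il /mmoment.
(* Subtracting [fps_one] alters only the constant coefficient. *)
have -> : \prod_(j < k) (umbra_gf E gamma j.+1 - fps_one j.+1) ^+ l j
   = \prod_(j < k) umbra_gf E gamma j.+1 ^+ l j.
  by apply: eq_bigr => j _; rewrite /fps_one subr0.
by rewrite !mulrA; congr (_ * _ * _); rewrite mulrC mulrA mulrAC.
Qed.
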